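(* Let $k$ be a field and $(A,C)_\psi$ an entwining structure such that the map $\psi:C\otimes_k A\to A\otimes_k C$ is bijective. Suppose that $e\in C$ is a group-like element and view $A$ as a right $C$-comodule with the coaction $\varrho^A:A\to A\otimes_k C$, $a\mapsto\psi(e\otimes a)$. If $C$ is a coseparable coalgebra and the (lifted) canonical map $$\widetilde{\mathrm{can}}:A\otimes_k A\to A\otimes_k C,\qquad a\otimes a'\mapsto a\varrho^A(a'),$$ is surjective, then $A$ is a principal $C$-extension of the coinvariants $S=A^{co\,C}$.
   Context: Algebras are associative and unital, coalgebras coassociative and counital, over $k$. An entwining structure $(A,C)_\psi$ consists of a $k$-algebra $A$ (product $\mu$), a $k$-coalgebra $C$ (coproduct $\Delta_C$, counit $\varepsilon_C$) and a $k$-linear map $\psi:C\otimes_k A\to A\otimes_k C$ such that $\psi\circ(C\otimes\mu)=(\mu\otimes C)\circ(A\otimes\psi)\circ(\psi\otimes A)$, $\psi(c\otimes 1)=1\otimes c$ for all $c\in C$, $(A\otimes\Delta_C)\circ\psi=(\psi\otimes C)\circ(C\otimes\psi)\circ(\Delta_C\otimes A)$, and $(A\otimes\varepsilon_C)\circ\psi=\varepsilon_C\otimes A$ (an object also denotes its identity map). An element $e\in C$ is group-like if $\Delta_C(e)=e\otimes e$ and $\varepsilon_C(e)=1$. A coalgebra $C$ is coseparable if $\Delta_C$ has a retraction in the category of $C$-bicomodules. Principal $C$-extension: let $A$ be an algebra and a right $C$-comodule via $\varrho^A:A\to A\otimes_k C$, and let $S=A^{co\,C}:=\{s\in A\mid\varrho^A(sa)=s\varrho^A(a)\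 \forall a\in A\}$, a subalgebra of $A$. The inclusion $S\subseteq A$ is a principal $C$-extension (one says $A$ is a principal $C$-extension of $S$) iff (1) $\mathrm{can}:A\otimes_S A\to A\otimes_k C$, $a\otimes a'\mapsto a\varrho^A(a')$, is bijective; (2) there exists a left $S$-module, right $C$-comodule section of the product map $S\otimes_k A\to A$ (where $S\otimes_k A$ has coaction $S\otimes\varrho^A$); (3) the map $C\otimes_k A\to A\otimes_k C$, $c\otimes a\mapsto\mathrm{can}(\mathrm{can}^{-1}(1\otimes c)a)$, is bijective; (4) there is a group-like element $e\in C$ such that, for all $a\in A$, $\varrho^A(a)$ is the image of $e\otimes a$ under the map in (3). *)

(* Defs.v *)
From HB Require Import structures.
From mathcomp Require Import all_boot all_algebra.
From mathcomp Require Import boolp classical_sets.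
From mathcomp Require Import freeg.

Set Implicit Arguments.
Unset Strict Implicit.
Unset Printing Implicit Defensive.

Import GRing.Theory Quotient.Exports.
Local Open Scope ring_scope.
Local Open Scope quotient_scope.

Reserved Notation "M ⊗ N" (at level 40, left associativity).
Reserved Notation "m ⊗ₜ n" (at level 40, left associativity).

Section QuotientSpace.
Variables (k : fieldType) (V : lmodType k).

Definition subspace (P : V -> Prop) : Prop :=
  P 0 /\ forall (a : k) (u v : V), P u -> P v -> P (a *: u + v).

Definition lspan (G : V -> Prop) (v : V) : bool :=
  `[< forall P, subspace P -> (forall g, G g -> P g) -> P v >].

Lemma lspan_closed (G : V -> Prop) : subsemimod_closed (lspan G).
Proof.
apply: GRing.submod_closed_semi; split; first by apply/asboolP => P [P0].
move=> a u v /asboolP uG /asboolP vG; apply/asboolP => P sP GP.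
by apply: sP.2; [exact: uG | exact: vG].
Qed.

HB.instance Definition _ (G : V -> Prop) :=
  GRing.isSubmodClosed.Build k V (lspan G)
    (lspan_closed G).

Variable G : V -> Prop.

Definition qspace : Type := Quotient.quot (lspan G : {pred V}).

HB.instance Definition _ := GRing.Zmodule.on qspace.
HB.instance Definition _ := Quotient.on qspace.

Definition qproj (v : V) : qspace := \pi_qspace v.

Lemma qprojP (u v : V) : reflect (qproj u = qproj v) (u - v \in lspan G).
Proof. by rewrite Quotient.idealrBE; exact: eqP. Qed.

Lemma qprojD : {morph qproj : u v / u + v}.
Proof. by move=> u v; rewrite /qproj (raddfD (\pi_(Quotient.quot (lspan G : {pred V})))). Qed.

Definition qscale (a : k) (x : qspace) : qspace := qproj (a *: repr x).

Lemma qprojZ (a : k) (v : V) : qproj (a *: v) = qscale a (qproj v).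
Proof.
apply/qprojP; rewrite -scalerBr rpredZ //; apply/qprojP.
by rewrite /qproj reprK.
Qed.

Lemma qprojW (x : qspace) : exists v, x = qproj v.
Proof. by exists (repr x); rewrite /qproj reprK. Qed.

Lemma qscaleA (a b : k) x : qscale a (qscale b x) = qscale (a * b) x.
Proof. by have [v ->] := qprojW x; rewrite -!qprojZ scalerA. Qed.

Lemma qscale1 : left_id 1 qscale.
Proof. by move=> x; have [v ->] := qprojW x; rewrite -qprojZ scale1r. Qed.

Lemma qscaleDr : right_distributive qscale +%R.
Proof.
move=> a x y; have [u ->] := qprojW x; have [v ->] := qprojW y.
by rewrite -qprojD -!qprojZ scalerDr qprojD.
Qed.

Lemma qscaleDl x : {morph qscale^~ x : a b / a + b}.
Proof.
by move=> a b; have [v ->] := qprojW x; rewrite -!qprojZ scalerDl qprojD.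
Qed.

HB.instance Definition _ :=
  GRing.Zmodule_isLmodule.Build k qspace qscaleA qscale1 qscaleDr qscaleDl.

Lemma qproj_linear : linear qproj.
Proof. by move=> a u v; rewrite qprojD qprojZ. Qed.

HB.instance Definition _ := GRing.isLinear.Build k V qspace *:%R qproj
  qproj_linear.

(* The map induced by f on the quotient; meaningful when f is linear and
   vanishes on G, see qliftE. *)
Definition qlift (W : lmodType k) (f : V -> W) (x : qspace) : W := f (repr x).

Lemma qliftE (W : lmodType k) (f : V -> W) :
  linear f -> (forall g, G g -> f g = 0) -> forall v, qlift f (qproj v) = f v.
Proof.
move=> lf fG v.
pose F : {linear V -> W} := HB.pack f (GRing.isLinear.Build k V W *:%R f lf).
rewrite /qlift; apply/eqP; rewrite -subr_eq0 -(raddfB F); apply/eqP.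
have /qprojP : qproj (repr (qproj v)) = qproj v by rewrite /qproj reprK.
move=> /asboolP /(_ (fun v => F v = 0)); apply; last exact: fG.
by split=> [|a u w u0 w0]; rewrite ?raddf0 // linearP u0 w0 scaler0 addr0.
Qed.

Lemma qlift_linear (W : lmodType k) (f : V -> W) :
  linear f -> (forall g, G g -> f g = 0) -> linear (qlift f).
Proof.
move=> lf fG a x y; have [u ->] := qprojW x; have [v ->] := qprojW y.
by rewrite -linearP !qliftE // lf.
Qed.

End QuotientSpace.

Section Tensor.
Variables (k : fieldType).

Inductive tensor_rel (M N : lmodType k) : {freeg (M * N) / k} -> Prop :=
| TensorDl m m' n :
    tensor_rel (<< (m + m', n) >> - << (m, n) >> - << (m', n) >>)
| TensorDr m n n' :
    tensor_rel (<< (m, n + n') >> - << (m, n) >> - << (m, n') >>)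
| TensorZl a m n : tensor_rel (<< (a *: m, n) >> - a *: << (m, n) >>)
| TensorZr a m n : tensor_rel (<< (m, a *: n) >> - a *: << (m, n) >>).

Definition tensor (M N : lmodType k) : Type := qspace (@tensor_rel M N).

HB.instance Definition _ (M N : lmodType k) := GRing.Lmodule.on (tensor M N).

Definition tpure (M N : lmodType k) (m : M) (n : N) : tensor M N :=
  qproj (@tensor_rel M N) << (m, n) >>.

(* The map on the tensor product induced by f; meaningful when f is bilinear,
   see tliftE. *)
Definition tlift (M N P : lmodType k) (f : M -> N -> P) : tensor M N -> P :=
  qlift (fglift (fun mn : M * N => f mn.1 mn.2)).

End Tensor.

Notation "M ⊗ N" := (tensor M N).
Notation "m ⊗ₜ n" := (tpure m n) : ring_scope.

Section TensorTheory.
Variables (k : fieldType).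
Implicit Types M N P L : lmodType k.

Definition bilinear_map M N P (f : M -> N -> P) : Prop :=
  (forall n, linear (f^~ n)) /\ (forall m, linear (f m)).

HB.instance Definition _ M (K : choiceType) (f : K -> M) :=
  GRing.isZmodMorphism.Build {freeg K / k} M (fglift f) (lift_is_additive f).

Lemma fglift_scalable M (K : choiceType) (f : K -> M) :
  scalable (fglift f : {freeg K / k} -> M).
Proof.
move=> a u; rewrite -[u]freeg_sumE scaler_sumr !raddf_sum /=.
apply: eq_bigr => x _.
have -> c d : c *: << d *g x >> = << c * d *g x >> :> {freeg K / k}.
  by apply/eqP/freeg_eqP => y; rewrite coeffZ !coeffU mulrA.
by rewrite !liftU scalerA.
Qed.

HB.instance Definition _ M (K : choiceType) (f : K -> M) :=
  GRing.isScalable.Build k {freeg K / k} M *:%R (fglift f)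
    (fglift_scalable f).

Lemma tlift_rel M N P (f : M -> N -> P) : bilinear_map f ->
  forall g, tensor_rel g -> fglift (fun mn : M * N => f mn.1 mn.2) g = 0.
Proof.
move=> [fl fr] g.
have FE m n : fglift (fun mn : M * N => f mn.1 mn.2) << (m, n) >> = f m n.
  by rewrite liftU scale1r.
pose fL n : {linear M -> P} :=
  HB.pack (f^~ n) (GRing.isLinear.Build k M P *:%R (f^~ n) (fl n)).
pose fR m : {linear N -> P} :=
  HB.pack (f m) (GRing.isLinear.Build k N P *:%R (f m) (fr m)).
case=> [m m' n|m n n'|a m n|a m n]; rewrite !raddfB /= ?linearZ /= !FE.
- by have /= -> := raddfD (fL n) m m'; rewrite addrAC addrK subrr.
- by have /= -> := raddfD (fR m) n n'; rewrite addrAC addrK subrr.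
- by have /= -> := linearZZ (fL n) a m; rewrite scalerN subrr.
- by have /= -> := linearZZ (fR m) a n; rewrite scalerN subrr.
Qed.

Lemma tliftE M N P (f : M -> N -> P) : bilinear_map f ->
  forall m n, tlift f (m ⊗ₜ n) = f m n.
Proof.
move=> bf m n; rewrite /tlift /tpure qliftE ?liftU ?scale1r //.
- exact: linearP.
- exact: tlift_rel.
Qed.

Lemma tlift_linear M N P (f : M -> N -> P) :
  bilinear_map f -> linear (tlift f).
Proof.
by move=> bf; apply: qlift_linear; [exact: linearP | exact: tlift_rel].
Qed.

Lemma tensor_rel0 M N g : tensor_rel g -> qproj (@tensor_rel k M N) g = 0.
Proof.
move=> Rg; rewrite -(raddf0 (qproj (@tensor_rel k M N))); apply/qprojP.
by rewrite subr0; apply/asboolP => Q _; apply.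
Qed.

Lemma tpureDl M N (m m' : M) (n : N) : (m + m') ⊗ₜ n = m ⊗ₜ n + m' ⊗ₜ n.
Proof.
have /eqP := tensor_rel0 (TensorDl m m' n).
by rewrite 2!raddfB /= -addrA -opprD subr_eq0 => /eqP.
Qed.

Lemma tpureDr M N (m : M) (n n' : N) : m ⊗ₜ (n + n') = m ⊗ₜ n + m ⊗ₜ n'.
Proof.
have /eqP := tensor_rel0 (TensorDr m n n').
by rewrite 2!raddfB /= -addrA -opprD subr_eq0 => /eqP.
Qed.

Lemma tpureZl M N a (m : M) (n : N) : (a *: m) ⊗ₜ n = a *: (m ⊗ₜ n).
Proof.
have /eqP := tensor_rel0 (TensorZl a m n).
by rewrite linearB linearZ /= subr_eq0 => /eqP.
Qed.

Lemma tpureZr M N a (m : M) (n : N) : m ⊗ₜ (a *: n) = a *: (m ⊗ₜ n).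
Proof.
have /eqP := tensor_rel0 (TensorZr a m n).
by rewrite linearB linearZ /= subr_eq0 => /eqP.
Qed.

Lemma tpure_bilinear M N : bilinear_map (@tpure k M N).
Proof.
by split=> [n a m m'|m a n n']; rewrite ?(tpureDl, tpureZl, tpureDr, tpureZr).
Qed.

Lemma tensor_ind M N (Q : M ⊗ N -> Prop) :
    (forall m n, Q (m ⊗ₜ n)) ->
    (forall (a : k) u v, Q u -> Q v -> Q (a *: u + v)) ->
  forall t, Q t.
Proof.
move=> Qp QP t; have [u ->] := qprojW t; rewrite -[u]freeg_sumE.
elim: (dom u) => [|[m n] s IHs]; rewrite ?big_nil ?big_cons.
  by have := QP (-1) _ _ (Qp 0 0) (Qp 0 0); rewrite scaleN1r addNr raddf0.
have -> c : << c *g (m, n) >> = c *: << (m, n) >> :> {freeg (M * N) / k}.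
  by apply/eqP/freeg_eqP => y; rewrite coeffZ !coeffU mul1r.
by rewrite linearP; apply: QP => //; exact: Qp.
Qed.

Lemma tlift_param M N P L (f : L -> M -> N -> P) :
    (forall l, bilinear_map (f l)) ->
    (forall m n, linear (fun l => f l m n)) ->
  forall t, linear (fun l => tlift (f l) t).
Proof.
move=> bf lf t a l l'; elim/tensor_ind: t => [m n|c u v uE vE].
  by rewrite !tliftE // lf.
rewrite !(tlift_linear (bf _)) uE vE !scalerDr !scalerA.
by rewrite [a * c]mulrC !addrA; congr (_ + _); rewrite addrAC.
Qed.

Definition tmap M M' N N' (f : M -> M') (g : N -> N') : M ⊗ N -> M' ⊗ N' :=
  tlift (fun m n => f m ⊗ₜ g n).

Definition assoc L M N : (L ⊗ M) ⊗ N -> L ⊗ (M ⊗ N) :=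
  tlift (fun t n => tlift (fun l m => l ⊗ₜ (m ⊗ₜ n)) t).

Definition assocV L M N : L ⊗ (M ⊗ N) -> (L ⊗ M) ⊗ N :=
  tlift (fun l t => tlift (fun m n => (l ⊗ₜ m) ⊗ₜ n) t).

Definition lunit M : k^o ⊗ M -> M := tlift (fun (a : k^o) m => a *: m).

Definition runit M : M ⊗ k^o -> M := tlift (fun m (a : k^o) => a *: m).

Lemma tmap_bilinear M M' N N' (f : {linear M -> M'}) (g : {linear N -> N'}) :
  bilinear_map (fun m n => f m ⊗ₜ g n).
Proof.
by split=> [n a m m'|m a n n'];
   rewrite linearP ?(tpureDl, tpureZl, tpureDr, tpureZr).
Qed.

Lemma tmapE M M' N N' (f : {linear M -> M'}) (g : {linear N -> N'}) m n :
  tmap f g (m ⊗ₜ n) = f m ⊗ₜ g n.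
Proof. exact: tliftE (tmap_bilinear f g) m n. Qed.

Lemma tmap_linear M M' N N' (f : {linear M -> M'}) (g : {linear N -> N'}) :
  linear (tmap f g).
Proof. exact: tlift_linear (tmap_bilinear f g). Qed.

HB.instance Definition _ M M' N N'
    (f : {linear M -> M'}) (g : {linear N -> N'}) :=
  GRing.isLinear.Build k (M ⊗ N) (M' ⊗ N') *:%R (tmap f g) (tmap_linear f g).

Let assoc_inner L M N (n : N) :
  bilinear_map (fun (l : L) (m : M) => l ⊗ₜ (m ⊗ₜ n)).
Proof.
by split=> [m a l l'|l a m m']; rewrite ?(tpureDl, tpureZl, tpureDr, tpureZr).
Qed.

Let assoc_outer L M N :
  bilinear_map
    (fun t (n : N) => tlift (fun (l : L) (m : M) => l ⊗ₜ (m ⊗ₜ n)) t).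
Proof.
split=> [n|t]; first exact/tlift_linear/assoc_inner.
apply: tlift_param; first exact: assoc_inner.
by move=> l m a n n'; rewrite !(tpureDr, tpureZr).
Qed.

Lemma assocE L M N (l : L) (m : M) (n : N) :
  assoc ((l ⊗ₜ m) ⊗ₜ n) = l ⊗ₜ (m ⊗ₜ n).
Proof. by rewrite /assoc tliftE ?tliftE. Qed.

Lemma assoc_linear L M N : linear (@assoc L M N).
Proof. exact/tlift_linear/assoc_outer. Qed.

HB.instance Definition _ L M N :=
  GRing.isLinear.Build k ((L ⊗ M) ⊗ N) (L ⊗ (M ⊗ N)) *:%R (@assoc L M N)
    (@assoc_linear L M N).

Let assocV_inner L M N (l : L) :
  bilinear_map (fun (m : M) (n : N) => (l ⊗ₜ m) ⊗ₜ n).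
Proof.
by split=> [n a m m'|m a n n']; rewrite ?(tpureDl, tpureZl, tpureDr, tpureZr).
Qed.

Let assocV_outer L M N :
  bilinear_map
    (fun (l : L) t => tlift (fun (m : M) (n : N) => (l ⊗ₜ m) ⊗ₜ n) t).
Proof.
split=> [t|l]; last exact/tlift_linear/assocV_inner.
apply: tlift_param; first exact: assocV_inner.
by move=> m n a l l'; rewrite !(tpureDl, tpureZl).
Qed.

Lemma assocVE L M N (l : L) (m : M) (n : N) :
  assocV (l ⊗ₜ (m ⊗ₜ n)) = (l ⊗ₜ m) ⊗ₜ n.
Proof. by rewrite /assocV tliftE ?tliftE. Qed.

Lemma assocV_linear L M N : linear (@assocV L M N).
Proof. exact/tlift_linear/assocV_outer. Qed.

HB.instance Definition _ L M N :=
  GRing.isLinear.Build k (L ⊗ (M ⊗ N)) ((L ⊗ M) ⊗ N) *:%R (@assocV L M N)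
    (@assocV_linear L M N).

Let lunit_bilinear M : bilinear_map (fun (a : k^o) (m : M) => a *: m).
Proof.
split=> [m c a b|a c m m']; first by rewrite scalerDl scalerA.
by rewrite scalerDr !scalerA mulrC.
Qed.

Lemma lunitE M (a : k^o) (m : M) : lunit (a ⊗ₜ m) = a *: m.
Proof. exact: tliftE. Qed.

Lemma lunit_linear M : linear (@lunit M).
Proof. exact: tlift_linear. Qed.

HB.instance Definition _ M :=
  GRing.isLinear.Build k (k^o ⊗ M) M *:%R (@lunit M) (@lunit_linear M).

Let runit_bilinear M : bilinear_map (fun (m : M) (a : k^o) => a *: m).
Proof. by have [? ?] := lunit_bilinear M; split. Qed.

Lemma runitE M (m : M) (a : k^o) : runit (m ⊗ₜ a) = a *: m.
Proof. exact: tliftE. Qed.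

Lemma runit_linear M : linear (@runit M).
Proof. exact: tlift_linear. Qed.

HB.instance Definition _ M :=
  GRing.isLinear.Build k (M ⊗ k^o) M *:%R (@runit M) (@runit_linear M).

End TensorTheory.

HB.mixin Record isCoalgebra (k : fieldType) C of GRing.Lmodule k C := {
  comul : {linear C -> C ⊗ C};
  counit : {linear C -> k^o};
  comulA : forall c : C,
    assoc (tmap comul idfun (comul c)) = tmap idfun comul (comul c);
  counitl : forall c : C, lunit (tmap counit idfun (comul c)) = c;
  counitr : forall c : C, runit (tmap idfun counit (comul c)) = c
}.

#[short(type="coalgType")]
HB.structure Definition Coalgebra (k : fieldType) :=
  {C of isCoalgebra k C & GRing.Lmodule k C}.

Section Coalgebra.
Variables (k : fieldType) (C : coalgType k).

Definition grouplike (e : C) : Prop :=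
  comul e = e ⊗ₜ e /\ counit e = 1.

Definition right_comodule (M : lmodType k) (rho : {linear M -> M ⊗ C}) : Prop :=
  (forall m, assoc (tmap rho idfun (rho m)) = tmap idfun comul (rho m)) /\
  (forall m, runit (tmap idfun counit (rho m)) = m).

Definition right_colinear (M N : lmodType k) (rhoM : M -> M ⊗ C)
    (rhoN : N -> N ⊗ C) (f : M -> N) : Prop :=
  forall m, rhoN (f m) = tmap f idfun (rhoM m).

Definition left_colinear (M N : lmodType k) (lamM : M -> C ⊗ M)
    (lamN : N -> C ⊗ N) (f : M -> N) : Prop :=
  forall m, lamN (f m) = tmap idfun f (lamM m).

(* The right coaction N ⊗ rho on N ⊗ M and the left coaction lam ⊗ N on
   M ⊗ N. *)
Definition tensor_rcoact (N M : lmodType k) (rho : M -> M ⊗ C) :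
  N ⊗ M -> (N ⊗ M) ⊗ C := @assocV k N M C \o tmap idfun rho.

Definition tensor_lcoact (M N : lmodType k) (lam : M -> C ⊗ M) :
  M ⊗ N -> C ⊗ (M ⊗ N) := @assoc k C M N \o tmap lam idfun.

End Coalgebra.

Definition coseparable (k : fieldType) (C : coalgType k) : Prop :=
  exists p : {linear C ⊗ C -> C},
    [/\ right_colinear (tensor_rcoact comul) comul p,
        left_colinear (tensor_lcoact comul) comul p
      & forall c, p (comul c) = c].

Section Entwining.
Variables (k : fieldType) (A : algType k) (C : coalgType k).

Definition tmul : A ⊗ A -> A := tlift *%R.

Record entwining (psi : {linear C ⊗ A -> A ⊗ C}) : Prop := {
  entwining_mul : forall t : C ⊗ (A ⊗ A),
    psi (tmap idfun tmul t) =
    tmap tmul idfun (assocV (tmap idfun psi (assoc (tmap psi idfun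
      (assocV t)))));
  entwining_one : forall c, psi (c ⊗ₜ 1) = 1 ⊗ₜ c;
  entwining_comul : forall t : C ⊗ A,
    tmap idfun comul (psi t) =
    assoc (tmap psi idfun (assocV (tmap idfun psi (assoc (tmap comul idfun
      t)))));
  entwining_counit : forall t : C ⊗ A,
    runit (tmap idfun counit (psi t)) = lunit (tmap counit idfun t)
}.

Definition entwined_coaction (psi : {linear C ⊗ A -> A ⊗ C}) (e : C) (a : A) :
  A ⊗ C := psi (e ⊗ₜ a).

Lemma entwined_coaction_linear psi e : linear (entwined_coaction psi e).
Proof.
by move=> a x y; rewrite /entwined_coaction tpureDr tpureZr linearP.
Qed.

HB.instance Definition _ psi e :=
  GRing.isLinear.Build k A (A ⊗ C) *:%R (entwined_coaction psi e)
    (entwined_coaction_linear psi e).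

End Entwining.

Section LeftAction.
Variables (k : fieldType) (B : algType k) (M : lmodType k).

Definition lact (b : B) : B ⊗ M -> B ⊗ M := tmap ( *%R b) idfun.

Let lact_bilinear (b : B) : bilinear_map (fun (b' : B) (m : M) => (b * b') ⊗ₜ m).
Proof.
split=> [m a x y|x a m m']; rewrite ?tpureDr ?tpureZr //.
by rewrite mulrDr -scalerAr tpureDl tpureZl.
Qed.

Lemma lactE (b b' : B) (m : M) : lact b (b' ⊗ₜ m) = (b * b') ⊗ₜ m.
Proof. exact: (tliftE (lact_bilinear b)). Qed.

Lemma lact_linear (b : B) : linear (lact b).
Proof. exact: (tlift_linear (lact_bilinear b)). Qed.

HB.instance Definition _ (b : B) :=
  GRing.isLinear.Build k (B ⊗ M) (B ⊗ M) *:%R (lact b) (lact_linear b).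

Lemma lact_linearl (t : B ⊗ M) : linear (lact^~ t).
Proof.
apply: (tlift_param lact_bilinear) => x m a b b'.
by rewrite mulrDl -scalerAl tpureDl tpureZl.
Qed.

Lemma lact1 (t : B ⊗ M) : lact 1 t = t.
Proof.
elim/tensor_ind: t => [b m|a u v uE vE]; first by rewrite lactE mul1r.
by rewrite lact_linear uE vE.
Qed.

Lemma lactM (b b' : B) (t : B ⊗ M) : lact (b * b') t = lact b (lact b' t).
Proof.
elim/tensor_ind: t => [x m|a u v uE vE]; first by rewrite !lactE mulrA.
by rewrite !lact_linear uE vE.
Qed.

End LeftAction.

Section PrincipalExtension.
Variables (k : fieldType) (A : algType k) (C : coalgType k).
Variable rho : {linear A -> A ⊗ C}.

Definition coinv (s : A) : bool :=
  `[< forall a, rho (s * a) = lact s (rho a) >].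

Lemma coinvP (s : A) :
  reflect (forall a, rho (s * a) = lact s (rho a)) (coinv s).
Proof. exact: asboolP. Qed.

Lemma coinv_closed : GRing.subsemialg_closed coinv.
Proof.
apply: GRing.subalg_closed_semi; split.
- by apply/coinvP => a; rewrite mul1r lact1.
- move=> c s s' /coinvP sP /coinvP s'P; apply/coinvP => a.
  by rewrite lact_linearl mulrDl -scalerAl linearP sP s'P.
- move=> s s' /coinvP sP /coinvP s'P; apply/coinvP => a.
  by rewrite -mulrA sP s'P lactM.
Qed.

HB.instance Definition _ := GRing.isSubalgClosed.Build k A coinv coinv_closed.

Definition coinvariants : Type := {s : A | coinv s}.

HB.instance Definition _ := SubChoice.on coinvariants.
HB.instance Definition _ := [SubChoice_isSubAlgebra of coinvariants by <:].

(* A ⊗_S A, for S the coinvariants, as a quotient of A ⊗ A. *)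
Inductive balanced_rel : A ⊗ A -> Prop :=
| Balanced (a a' s : A) of coinv s :
    balanced_rel ((a * s) ⊗ₜ a' - a ⊗ₜ (s * a')).

Definition tensorS : Type := qspace balanced_rel.

HB.instance Definition _ := GRing.Lmodule.on tensorS.

Definition tpureS (a a' : A) : tensorS := qproj balanced_rel (a ⊗ₜ a').

Definition lifted_can : A ⊗ A -> A ⊗ C := tlift (fun a a' => lact a (rho a')).

Let lifted_can_bilinear : bilinear_map (fun a a' => lact a (rho a')).
Proof.
split=> [a'|a c x y]; first exact: lact_linearl.
by rewrite !linearP.
Qed.

Lemma lifted_canE a a' : lifted_can (a ⊗ₜ a') = lact a (rho a').
Proof. exact: (tliftE lifted_can_bilinear). Qed.

Lemma lifted_can_linear : linear lifted_can.
Proof. exact: (tlift_linear lifted_can_bilinear). Qed.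

HB.instance Definition _ :=
  GRing.isLinear.Build k (A ⊗ A) (A ⊗ C) *:%R lifted_can lifted_can_linear.

Definition can : tensorS -> A ⊗ C := qlift lifted_can.

Let lifted_can_balanced t : balanced_rel t -> lifted_can t = 0.
Proof.
by case=> a a' s /coinvP sP; rewrite linearB /= !lifted_canE sP lactM subrr.
Qed.

Lemma canE a a' : can (tpureS a a') = lact a (rho a').
Proof.
rewrite -lifted_canE; apply: qliftE; first exact: lifted_can_linear.
exact: lifted_can_balanced.
Qed.

Lemma can_linear : linear can.
Proof.
by apply: qlift_linear; [exact: lifted_can_linear|exact: lifted_can_balanced].
Qed.

HB.instance Definition _ :=
  GRing.isLinear.Build k tensorS (A ⊗ C) *:%R can can_linear.

(* The right action of b on A ⊗_S A. *)
Definition ractS (b : A) : tensorS -> tensorS :=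
  qlift (tlift (fun a a' => tpureS a (a' * b))).

Let ractS_bilinear b : bilinear_map (fun a a' => tpureS a (a' * b)).
Proof.
split=> [a' c x y|x c a a']; rewrite /tpureS -linearP.
  by rewrite tpureDl tpureZl.
by rewrite mulrDl -scalerAl tpureDr tpureZr.
Qed.

Let ractS_balanced b t :
  balanced_rel t -> tlift (fun a a' => tpureS a (a' * b)) t = 0.
Proof.
case=> a a' s sS; rewrite addrC -scaleN1r (tlift_linear (ractS_bilinear b)).
rewrite scaleN1r !tliftE // addrC /tpureS -linearB /= -mulrA.
apply/eqP; rewrite -(raddf0 (qproj balanced_rel)); apply/eqP/qprojP.
by rewrite subr0; apply/asboolP => Q _; apply; exact: Balanced.
Qed.

Lemma ractSE a a' b : ractS b (tpureS a a') = tpureS a (a' * b).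
Proof.
rewrite -(tliftE (ractS_bilinear b)); apply: qliftE.
  exact: tlift_linear.
exact: ractS_balanced.
Qed.

Lemma ractS_linear b : linear (ractS b).
Proof.
apply: qlift_linear; last exact: ractS_balanced.
exact: tlift_linear.
Qed.

Lemma ractS_linearr (x : tensorS) : linear (ractS^~ x).
Proof.
move=> c b b'; have [t ->] := qprojW x.
have E d : ractS d (qproj balanced_rel t) =
           tlift (fun a a' => tpureS a (a' * d)) t.
  by apply: qliftE; [exact: tlift_linear|exact: ractS_balanced].
rewrite !E (tlift_param ractS_bilinear) // => a a' e d d'.
by rewrite /tpureS -linearP mulrDr -scalerAr tpureDr tpureZr.
Qed.

(* The inverse of can; meaningful when can is bijective, see can_invK. *)
Definition can_inv (y : A ⊗ C) : tensorS := xget 0 [set x | can x = y].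

Lemma can_invK : bijective can -> cancel can can_inv /\ cancel can_inv can.
Proof.
case=> g gK Kg; have invK y : can (can_inv y) = y.
  by have := xgetPex 0 (ex_intro (fun x => can x = y) (g y) (Kg y)).
by split=> // x; apply: (can_inj gK); rewrite invK.
Qed.

(* c ⊗ a |-> can (can^-1 (1 ⊗ c) a) *)
Definition can_entwining : C ⊗ A -> A ⊗ C :=
  tlift (fun c a => can (ractS a (can_inv (1 ⊗ₜ c)))).

Lemma can_entwiningE : bijective can ->
  forall c a, can_entwining (c ⊗ₜ a) = can (ractS a (can_inv (1 ⊗ₜ c))).
Proof.
move=> bcan c a; have [canK invK] := can_invK bcan.
rewrite /can_entwining tliftE //; split=> [b|x] d u v.
  rewrite tpureDr tpureZr; set y := 1 ⊗ₜ u; set z := 1 ⊗ₜ v.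
  have -> : can_inv (d *: y + z) = d *: can_inv y + can_inv z.
    by apply: (bij_inj bcan); rewrite can_linear !invK.
  by rewrite ractS_linear can_linear.
by rewrite ractS_linearr can_linear.
Qed.

Definition mulSA : coinvariants ⊗ A -> A :=
  tlift (fun (s : coinvariants) a => val s * a).

Lemma mulSAE (s : coinvariants) a : mulSA (s ⊗ₜ a) = val s * a.
Proof.
rewrite /mulSA tliftE //; split=> [b|x] c u v.
  by rewrite linearP mulrDl -scalerAl.
by rewrite mulrDr -scalerAr.
Qed.

Record principal_extension : Prop := {
  principal_comodule : right_comodule rho;
  principal_can : bijective can;
  principal_section : exists sigma : {linear A -> coinvariants ⊗ A},
    [/\ forall (s : coinvariants) a, sigma (val s * a) = lact s (sigma a),
        right_colinear rho (tensor_rcoact rho) sigma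
      & cancel sigma mulSA];
  principal_bij : bijective can_entwining;
  principal_grouplike : exists2 e : C, grouplike e &
    forall a, rho a = can_entwining (e ⊗ₜ a)
}.

End PrincipalExtension.

(* Main.v *)
From HB Require Import structures.
Require Import Defs.
From mathcomp Require Import all_boot all_algebra.
From mathcomp Require Import boolp classical_sets.

(** Everything comes from one linear map ell : C -> A ⊗ A, a strong connection:
    it satisfies can~ (ell c) = 1 ⊗ c (here can~ is the lifted canonical map)
    and is colinear on both sides, for the right coaction rho a = psi (e ⊗ a)
    on the right factor and the left coaction lam a = psi^-1 (a ⊗ e) on the left
    factor.

    Existence of ell.  The map can~ is onto, so over a field it has a linear
    section (linear_section), and restricting that section to 1 ⊗ C gives a
    linear map C -> A ⊗ A which in general is colinear on neither side.
    Coseparability repairs this.  Let p be the bicolinear retraction of the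
    coproduct.  For any right comodule M the map
    m ⊗ c |-> m_0 counit (p (m_1 ⊗ c)) is right colinear (raverage_colinear),
    and symmetrically on the left; averaging the section first on the right and
    then on the left makes it bicolinear (ell_right, ell_left).  It stays a
    section (ell_can) because can~ intertwines the averaging maps of A ⊗ A with
    p itself: on the right by rho (m_0 counit (p (m_1 ⊗ c))) = m_0 ⊗ p (m_1 ⊗ c)
    (raverage_push), on the left because psi^-1 o can~ is
    a ⊗ b |-> lam a . b (lifted_can_left).

    Use of ell.  Put kappa (a ⊗ c) = a ell c.  This is a left A-linear and right
    C-colinear section of can~.  Left colinearity of ell says that the left
    factor of kappa (rho a) is coinvariant (can_section_coinv), hence
    kappa (rho a) lies in the image of S ⊗ A.  To lift it there without choosing
    bases, coseparability is used once more: a |-> a_0 counit (p (a_1 ⊗ e)) is a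
    linear projection of A onto S (raverage_coinv, coinv_projK).  The lift sigma
    is the required splitting of the product S ⊗ A -> A, because applying
    the counit to can~ (kappa (rho a)) = rho a gives back a.  The inverse of can
    is kappa followed by the quotient map: a kappa (rho b) comes from
    a ⊗ sigma b, and balancing over S turns it into a ⊗ b (can_sectionK_proj).
    Finally can~ is right A-linear, so c ⊗ a |-> can (can^-1 (1 ⊗ c) a) is psi
    (can_entwining_psi), which gives the remaining two conditions. *)

Set Implicit Arguments.
Unset Strict Implicit.
Unset Printing Implicit Defensive.

Import GRing.Theory.
Local Open Scope ring_scope.

(** * Linear sections of surjections *)

Section LinearSection.
Variables (k : fieldType) (V W : lmodType k) (f : {linear V -> W}).

(** Closure under combinations a u + v does not force 0 in U, so that the empty
    union is admitted when the sets are ordered by inclusion. *)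
Definition transversal (U : set V) : Prop :=
  (forall (a : k) u v, U u -> U v -> U (a *: u + v)) /\
  (forall u, U u -> f u = 0 -> u = 0).

(** A maximal transversal complements the kernel: a vector v whose image is
    missed by U could be adjoined to U together with its multiples. *)
Lemma ex_transversal_complement :
  exists U, [/\ transversal U, U 0 & forall v, exists2 u, U u & f u = f v].
Proof.
have [F sF totF|U [[Ulin Uker] Umax]] := @Zorn_bigcup V transversal.
  split=> [a u v [X FX Xu] [Y FY Yv]|u [X FX Xu]]; last exact: (sF X FX).2.
  have [Z [FZ Zu Zv]] : exists Z, [/\ F Z, Z u & Z v].
    by case: (totF X Y FX FY) => sXY; [exists Y | exists X]; split=> //; apply: sXY.
  by exists Z => //; apply: (sF Z FZ).1.
(* U0 is U with 0 adjoined, since U may be empty. *)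
pose U0 : set V := fun u => U u \/ u = 0.
have U0lin a u v : U0 u -> U0 v -> U0 (a *: u + v).
  move=> [Uu|->] [Uv|->]; rewrite ?scaler0 ?addr0 ?add0r; try by [left|right].
  - by left; apply: Ulin.
  - have -> : a *: u = (a - 1) *: u + u by rewrite scalerBl scale1r subrK.
    by left; apply: Ulin.
have U0ker u : U0 u -> f u = 0 -> u = 0 by case=> [/Uker|].
have Umeets v : exists2 u, U0 u & f u = f v.
  have [//|nv] := pselect (exists2 u, U0 u & f u = f v).
  pose U' : set V := fun x => exists2 a, U0 (x - a *: v) & True.
  exfalso; apply: (Umax U').
    split=> [x Ux|sU'U]; first by exists 0; rewrite // scale0r subr0; left.
    apply: nv; exists v => //; left; apply: sU'U; exists 1 => //; right.
    by rewrite scale1r subrr.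
  split=> [a x y [b xb _] [c yc _]|x [b xb _] fx0].
    exists (a * b + c) => //.
    have -> : a *: x + y - (a * b + c) *: v = a *: (x - b *: v) + (y - c *: v).
      by rewrite scalerBr scalerA scalerDl opprD addrACA.
    exact: U0lin.
  have [b0|b0] := eqVneq b 0.
    by apply: U0ker => //; move: xb; rewrite b0 scale0r subr0.
  (* x in the kernel and x - b v in U0: solve for f v. *)
  case: nv; exists ((- b^-1) *: (x - b *: v) + 0); first by apply: U0lin => //; right.
  rewrite addr0 linearZ linearB linearZ /= fx0 sub0r scalerN scaleNr opprK.
  by rewrite scalerA mulVf // scale1r.
by exists U0; split=> //; right.
Qed.

Lemma linear_section : (forall w, exists v, f v = w) ->
  exists s : {linear W -> V}, cancel s f.
Proof.
move=> fsurj; have [U [[Ulin Uker] U0 Umeets]] := ex_transversal_complement.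
have /choice[s sP] w : exists u, U u /\ f u = w.
  have [v <-] := fsurj w; have [u Uu fu] := Umeets v.
  by exists u.
have slin : linear s.
  move=> a x y; apply/eqP; rewrite -subr_eq0; apply/eqP/Uker.
    rewrite [_ - _]addrC -scaleN1r; apply: (Ulin); last exact: (sP _).1.
    by apply: (Ulin); exact: (sP _).1.
  by rewrite linearB linearP /= !(sP _).2 subrr.
pose S : {linear W -> V} := HB.pack s (GRing.isLinear.Build k W V *:%R s slin).
by exists S => w; exact: (sP w).2.
Qed.

End LinearSection.

(** * Linear maps between tensor products *)

Section LinearCombinators.
Variable k : fieldType.
Implicit Types L M N P : lmodType k.

(** A bundle-free form of linearity.  The coactions and averaging maps below are
    iterated composites, and proving this predicate by following their syntax
    avoids inferring a bundled structure on each composite. *)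
Definition lin M N (f : M -> N) : Prop :=
  forall a u v, f (a *: u + v) = a *: f u + f v.

Lemma lin_linear M N (f : {linear M -> N}) : lin f.
Proof. exact: linearP. Qed.

Lemma lin_id M : lin (fun x : M => x).
Proof. by []. Qed.

Lemma linZ M N (f : M -> N) a u : lin f -> f (a *: u) = a *: f u.
Proof.
move=> lf; have f0 : f 0 = 0 by rewrite -(addNr 0) -scaleN1r lf scaleN1r addNr.
by rewrite -[a *: u]addr0 lf f0 addr0.
Qed.

Lemma lin_comp L M N (f : M -> N) (g : L -> M) :
  lin f -> lin g -> lin (fun x => f (g x)).
Proof. by move=> lf lg a x y; rewrite lg lf. Qed.

Lemma lin_tpurel L M N (g : L -> M) (n : N) :
  lin g -> lin (fun x => g x ⊗ₜ n).
Proof. by move=> lg a x y; rewrite lg tpureDl tpureZl. Qed.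

Lemma lin_tpurer L M N (m : M) (g : L -> N) :
  lin g -> lin (fun x => m ⊗ₜ g x).
Proof. by move=> lg a x y; rewrite lg tpureDr tpureZr. Qed.

Lemma tensor_ext M N P (F G : M ⊗ N -> P) : lin F -> lin G ->
  (forall m n, F (m ⊗ₜ n) = G (m ⊗ₜ n)) -> forall t, F t = G t.
Proof.
move=> lF lG FG; elim/tensor_ind=> // a u v Fu Fv.
by rewrite lF lG Fu Fv.
Qed.

Lemma tmap_lin_bilinear M M' N N' (f : M -> M') (g : N -> N') :
  lin f -> lin g -> bilinear_map (fun m n => f m ⊗ₜ g n).
Proof.
by move=> lf lg; split=> [n a m m'|m a n n'];
   rewrite ?lf ?lg ?(tpureDl, tpureZl, tpureDr, tpureZr).
Qed.

Lemma tmapL M M' N N' (f : M -> M') (g : N -> N') m n :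
  lin f -> lin g -> tmap f g (m ⊗ₜ n) = f m ⊗ₜ g n.
Proof. by move=> lf lg; exact: tliftE (tmap_lin_bilinear lf lg) m n. Qed.

Lemma lin_tmap M M' N N' (f : M -> M') (g : N -> N') :
  lin f -> lin g -> lin (tmap f g).
Proof. by move=> lf lg; exact: tlift_linear (tmap_lin_bilinear lf lg). Qed.

Lemma lin_assoc L M N : lin (@assoc k L M N).
Proof. exact: assoc_linear. Qed.

Lemma lin_assocV L M N : lin (@assocV k L M N).
Proof. exact: assocV_linear. Qed.

Lemma lin_lunit M : lin (@lunit k M).
Proof. exact: lunit_linear. Qed.

Lemma lin_runit M : lin (@runit k M).
Proof. exact: runit_linear. Qed.

Lemma lin_lact (B : algType k) M (b : B) : lin (@lact k B M b).
Proof. exact: lact_linear. Qed.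
End LinearCombinators.
Arguments lin {k M N} f.

Create HintDb lin.
#[local] Hint Resolve lin_assoc lin_assocV lin_lunit lin_runit lin_lact lin_linear : lin.

(** Linearity by recursion on the syntax of the map; the factor of a pure tensor
    that contains the variable is found by trying both. *)
Ltac prove_lin :=
  lazymatch goal with
  | |- lin (fun x => x) => exact: lin_id
  | |- lin idfun => exact: lin_id
  | |- lin (_ \o _) => apply: lin_comp; prove_lin
  | |- lin (tmap _ _) => apply: lin_tmap; prove_lin
  | |- lin (tpure _) => apply: lin_tpurer; exact: lin_id
  | |- lin (fun x => _ ⊗ₜ _) =>
      first [apply: lin_tpurel; prove_lin | apply: lin_tpurer; prove_lin]
  | |- lin (fun x => ?f (@?g x)) =>
      first [solve [auto with lin nocore] | apply: (@lin_comp _ _ _ _ f g); prove_lin]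
  | |- lin _ => solve [assumption | auto with lin nocore]
  end.

(** Reduces an identity between two maps that are linear in t to pure tensors;
    this replaces the sum over Sweedler components. *)
Ltac by_tensors t := move: t; apply: tensor_ext; [prove_lin | prove_lin |].
Ltac tensor_simp := rewrite /= ?(tmapL, assocE, assocVE, lunitE, runitE, lactE) /=; try prove_lin.

(* Rewriting would otherwise unfold tensors down to free modules. *)
Local Opaque tensor tmap assoc assocV lunit runit tlift qlift qspace tpure.

Section TensorIdentities.
Variable k : fieldType.
Implicit Types L M N P : lmodType k.

Lemma tmap_cancel M M' N N' (f : M -> M') (f' : M' -> M)
    (g : N -> N') (g' : N' -> N) : lin f -> lin f' -> lin g -> lin g' ->
  cancel f f' -> cancel g g' -> cancel (tmap f g) (tmap f' g').
Proof. by move=> ? ? ? ? fK gK t; by_tensors t=> m n; tensor_simp; rewrite fK gK. Qed.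

Lemma assocK L M N : cancel (@assoc k L M N) (@assocV k L M N).
Proof.
move=> t; by_tensors t=> u n; by_tensors u=> l m.
by tensor_simp.
Qed.

Lemma assocVK L M N : cancel (@assocV k L M N) (@assoc k L M N).
Proof.
move=> t; by_tensors t=> l u; by_tensors u=> m n.
by tensor_simp.
Qed.
End TensorIdentities.

(** * Averaging over a coseparable coalgebra *)

Section CounitTensor.
Variables (k : fieldType) (C : coalgType k).
Implicit Types M : lmodType k.

Lemma counitr_tensor M (y : M ⊗ C) :
  runit (tmap idfun counit (assocV (tmap idfun comul y))) = y.
Proof.
by_tensors y=> m c; rewrite -[in RHS](counitr c); tensor_simp.
by move: (comul c) => u; by_tensors u=> x z; tensor_simp; rewrite tpureZr.
Qed.

Lemma counitl_tensor M (y : C ⊗ M) :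
  lunit (tmap counit idfun (assoc (tmap comul idfun y))) = y.
Proof.
by_tensors y=> c m; rewrite -[in RHS](counitl c); tensor_simp.
by move: (comul c) => u; by_tensors u=> x z; tensor_simp; rewrite tpureZl.
Qed.

End CounitTensor.

Section RightAveraging.
Variables (k : fieldType) (C : coalgType k) (M : lmodType k).
Variables (rho : M -> M ⊗ C) (p : C ⊗ C -> C).
Hypotheses (rho_lin : lin rho) (p_lin : lin p).
Hypothesis rhoA :
  forall m, assoc (tmap rho idfun (rho m)) = tmap idfun comul (rho m).
Hypothesis p_left : left_colinear (tensor_lcoact comul) comul p.
Hypothesis p_right : right_colinear (tensor_rcoact comul) comul p.

(** m ⊗ c |-> m_0 ⊗ p (m_1 ⊗ c) *)
Definition rpush (t : M ⊗ C) : M ⊗ C := tmap idfun p (assoc (tmap rho idfun t)).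

(** m ⊗ c |-> m_0 counit (p (m_1 ⊗ c)), the retraction of rho that makes every
    comodule over a coseparable coalgebra relatively injective *)
Definition raverage (t : M ⊗ C) : M := runit (tmap idfun counit (rpush t)).

Lemma lin_rpush : lin rpush.
Proof. by rewrite /rpush; prove_lin. Qed.

Lemma lin_raverage : lin raverage.
Proof. by move: lin_rpush => ?; rewrite /raverage; prove_lin. Qed.

(** Left colinearity of p moves the coproduct of p (m_1 ⊗ c) onto m_1, where
    coassociativity of rho turns it into a second application of rho. *)
Lemma rpush_coact t :
  tmap rho idfun (rpush t) = assocV (tmap idfun comul (rpush t)).
Proof.
move: lin_rpush => ?.
by_tensors t=> m c; rewrite /rpush; tensor_simp.
pose G (y : (M ⊗ C) ⊗ C) := tmap idfun p (assoc (y ⊗ₜ c)).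
have Glin : lin G by rewrite /G; prove_lin.
transitivity (G (tmap rho idfun (rho m))).
  by move: (rho m) => u; by_tensors u=> n d; rewrite /G; tensor_simp.
rewrite -[tmap rho idfun (rho m)]assocK rhoA.
move: (rho m) => u; by_tensors u=> n d; tensor_simp; rewrite p_left /tensor_lcoact; tensor_simp.
by move: (comul d) => v; by_tensors v=> x y; rewrite /G; tensor_simp.
Qed.

(** By rpush_coact the coaction recovers the component of rpush that
    the counit has erased. *)
Lemma raverage_push t : rho (raverage t) = rpush t.
Proof.
move: lin_rpush => ?; rewrite -[RHS]counitr_tensor -rpush_coact /raverage.
move: (rpush t) => u; by_tensors u=> n d; tensor_simp.
by rewrite linZ.
Qed.

(** With raverage_push this is right colinearity of p. *)
Lemma raverage_colinear t :
  rho (raverage t) = tmap raverage idfun (assocV (tmap idfun comul t)).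
Proof.
move: lin_rpush lin_raverage => ? ?; rewrite raverage_push.
by_tensors t=> m c; tensor_simp; rewrite /rpush; tensor_simp.
pose W (w : (M ⊗ C) ⊗ C) := runit (tmap idfun counit (tmap idfun p (assoc w))).
have Wlin : lin W by rewrite /W; prove_lin.
transitivity (tmap W idfun (assocV (rho m ⊗ₜ comul c))); last first.
  move: (comul c) => v; by_tensors v=> x y; tensor_simp.
  by rewrite /raverage /rpush; tensor_simp.
move: (rho m) => u; by_tensors u=> n d; tensor_simp.
rewrite -[p _ in LHS]counitl p_right /tensor_rcoact; tensor_simp.
by move: (comul c) => v; by_tensors v=> x y; rewrite /W; tensor_simp; rewrite tpureZl tpureZr.
Qed.

End RightAveraging.

Section LeftAveraging.
Variables (k : fieldType) (C : coalgType k) (M : lmodType k).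
Variables (lam : M -> C ⊗ M) (p : C ⊗ C -> C).
Hypotheses (lam_lin : lin lam) (p_lin : lin p).
Hypothesis lamA :
  forall m, assoc (tmap comul idfun (lam m)) = tmap idfun lam (lam m).
Hypothesis p_left : left_colinear (tensor_lcoact comul) comul p.
Hypothesis p_right : right_colinear (tensor_rcoact comul) comul p.

(** c ⊗ m |-> p (c ⊗ m_(-1)) ⊗ m_0 *)
Definition lpush (t : C ⊗ M) : C ⊗ M := tmap p idfun (assocV (tmap idfun lam t)).

Definition laverage (t : C ⊗ M) : M := lunit (tmap counit idfun (lpush t)).

Lemma lin_lpush : lin lpush.
Proof. by rewrite /lpush; prove_lin. Qed.

Lemma lin_laverage : lin laverage.
Proof. by move: lin_lpush => ?; rewrite /laverage; prove_lin. Qed.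

Lemma lpush_coact t :
  tmap idfun lam (lpush t) = assoc (tmap comul idfun (lpush t)).
Proof.
move: lin_lpush => ?.
by_tensors t=> c m; rewrite /lpush; tensor_simp.
pose G (y : C ⊗ (C ⊗ M)) := tmap p idfun (assocV (c ⊗ₜ y)).
have Glin : lin G by rewrite /G; prove_lin.
transitivity (G (tmap idfun lam (lam m))).
  by move: (lam m) => u; by_tensors u=> d n; rewrite /G; tensor_simp.
rewrite -lamA.
move: (lam m) => u; by_tensors u=> d n; tensor_simp; rewrite p_right /tensor_rcoact; tensor_simp.
by move: (comul d) => v; by_tensors v=> x y; rewrite /G; tensor_simp.
Qed.

Lemma laverage_push t : lam (laverage t) = lpush t.
Proof.
move: lin_lpush => ?; rewrite -[RHS]counitl_tensor -lpush_coact /laverage.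
move: (lpush t) => u; by_tensors u=> d n; tensor_simp.
by rewrite linZ.
Qed.

Lemma laverage_colinear t :
  lam (laverage t) = tmap idfun laverage (assoc (tmap comul idfun t)).
Proof.
move: lin_lpush lin_laverage => ? ?; rewrite laverage_push.
by_tensors t=> c m; tensor_simp; rewrite /lpush; tensor_simp.
pose W (w : C ⊗ (C ⊗ M)) := lunit (tmap counit idfun (tmap p idfun (assocV w))).
have Wlin : lin W by rewrite /W; prove_lin.
transitivity (tmap idfun W (assoc (comul c ⊗ₜ lam m))); last first.
  move: (comul c) => v; by_tensors v=> x y; tensor_simp.
  by rewrite /laverage /lpush; tensor_simp.
move: (lam m) => u; by_tensors u=> d n; tensor_simp.
rewrite -[p _ in LHS]counitr p_left /tensor_lcoact; tensor_simp.
by move: (comul c) => v; by_tensors v=> x y; rewrite /W; tensor_simp; rewrite tpureZl tpureZr.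
Qed.

End LeftAveraging.

(** * Entwined multiplication and coactions *)

Section LeftMultiplication.
Variables (k : fieldType) (A : algType k).

Let mul_bilinear : bilinear_map (@GRing.mul A).
Proof.
by split=> [n a x y|m a x y]; rewrite ?mulrDl ?mulrDr -?scalerAl -?scalerAr.
Qed.

Lemma tmulE (a b : A) : tmul (a ⊗ₜ b) = a * b.
Proof. exact: (tliftE mul_bilinear). Qed.

Lemma lin_tmul : lin (@tmul k A).
Proof. exact: (tlift_linear mul_bilinear). Qed.

Lemma lin_mulr (b : A) : lin (fun x : A => x * b).
Proof. exact: mul_bilinear.1. Qed.

Lemma lin_mull (a : A) : lin ( *%R a : A -> A).
Proof. exact: mul_bilinear.2. Qed.

(** The left action of A on A ⊗ M as a map defined on a tensor product, so that
    it can be composed with other linear maps. *)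
Definition lmul (M : lmodType k) (t : A ⊗ (A ⊗ M)) : A ⊗ M :=
  tmap (@tmul k A) idfun (assocV t).

End LeftMultiplication.
#[local] Hint Resolve lin_tmul lin_mulr lin_mull : lin.

Lemma lin_lmul (k : fieldType) (A : algType k) (M : lmodType k) : lin (@lmul k A M).
Proof. by rewrite /lmul; prove_lin. Qed.
#[local] Hint Resolve lin_lmul : lin.

Lemma lmulE (k : fieldType) (A : algType k) (M : lmodType k) (a : A) (u : A ⊗ M) :
  lmul (a ⊗ₜ u) = lact a u.
Proof. by by_tensors u=> b m; rewrite /lmul; tensor_simp; rewrite tmulE. Qed.

Lemma lact_tmap (k : fieldType) (A : algType k) (M N : lmodType k)
    (f : M -> N) (a : A) (u : A ⊗ M) :
  lin f -> tmap idfun f (lact a u) = lact a (tmap idfun f u).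
Proof. by move=> lf; by_tensors u=> b m; tensor_simp. Qed.

Section Entwined.
Variables (k : fieldType) (A : algType k) (C : coalgType k).
Variables (psi : {linear C ⊗ A -> A ⊗ C}) (e : C).
Hypotheses (psi_entw : entwining psi) (e_grp : grouplike e).

(** (a ⊗ c) b = a psi (c ⊗ b), the right A-module structure on A ⊗ C *)
Definition ract (t : (A ⊗ C) ⊗ A) : A ⊗ C := lmul (tmap idfun psi (assoc t)).

Lemma lin_ract : lin ract.
Proof. by rewrite /ract; prove_lin. Qed.
#[local] Hint Resolve lin_ract : lin.

Lemma ractE (a : A) c (b : A) : ract ((a ⊗ₜ c) ⊗ₜ b) = lact a (psi (c ⊗ₜ b)).
Proof. by rewrite /ract; tensor_simp; rewrite lmulE. Qed.

Lemma psi_mul c (a b : A) : psi (c ⊗ₜ (a * b)) = ract (psi (c ⊗ₜ a) ⊗ₜ b).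
Proof.
have := entwining_mul psi_entw (c ⊗ₜ (a ⊗ₜ b)).
by tensor_simp; rewrite tmulE.
Qed.

Lemma ract_lact (a : A) u (b : A) : ract (lact a u ⊗ₜ b) = lact a (ract (u ⊗ₜ b)).
Proof. by by_tensors u=> x c; tensor_simp; rewrite !ractE lactM. Qed.

Local Notation rho := (entwined_coaction psi e).

Lemma lin_coaction : lin rho.
Proof. exact: entwined_coaction_linear. Qed.
#[local] Hint Resolve lin_coaction : lin.

Lemma coaction_mul (a b : A) : rho (a * b) = ract (rho a ⊗ₜ b).
Proof. exact: psi_mul. Qed.

Lemma coaction_one : rho 1 = 1 ⊗ₜ e.
Proof. exact: entwining_one. Qed.

Lemma coactionA a : assoc (tmap rho idfun (rho a)) = tmap idfun comul (rho a).
Proof.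
rewrite /entwined_coaction (entwining_comul psi_entw); tensor_simp; rewrite e_grp.1; tensor_simp.
by move: (psi _) => u; by_tensors u=> x c; tensor_simp.
Qed.

Lemma coaction_counit a : runit (tmap idfun counit (rho a)) = a.
Proof.
by rewrite /entwined_coaction (entwining_counit psi_entw); tensor_simp; rewrite e_grp.2 scale1r.
Qed.

Lemma entwined_comodule : right_comodule rho.
Proof. by split; [exact: coactionA | exact: coaction_counit]. Qed.

Lemma lin_lifted_can : lin (lifted_can rho).
Proof. exact: lifted_can_linear. Qed.
#[local] Hint Resolve lin_lifted_can : lin.

(** lifted_canE with rho free of its bundled linear structure, the form in which
    it rewrites together with coaction_mul *)
Lemma lifted_can_pure a b : lifted_can rho (a ⊗ₜ b) = lact a (rho b).
Proof. exact: lifted_canE. Qed.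

Lemma lifted_can_lact a t : lifted_can rho (lact a t) = lact a (lifted_can rho t).
Proof. by by_tensors t=> x y; tensor_simp; rewrite !lifted_can_pure lactM. Qed.

Lemma lifted_can_ract t (b : A) :
  lifted_can rho (tmap idfun (fun x : A => x * b) t) = ract (lifted_can rho t ⊗ₜ b).
Proof.
by by_tensors t=> x y; tensor_simp; rewrite !lifted_can_pure coaction_mul ract_lact.
Qed.

Lemma lifted_can_counit t :
  runit (tmap idfun counit (lifted_can rho t)) = tmul t.
Proof.
by_tensors t=> a b; rewrite lifted_can_pure tmulE -[in RHS](coaction_counit b).
by move: (rho b) => u; by_tensors u=> x c; tensor_simp; rewrite scalerAr.
Qed.

(** Since rho (s a) = rho s . a, coinvariance of s only depends on rho s. *)
Lemma coinv_of_coaction s : rho s = s ⊗ₜ e -> coinv rho s.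
Proof.
move=> sE; apply/coinvP => a.
by apply: etrans (coaction_mul s a) _; rewrite sE ractE.
Qed.

Lemma coaction_of_coinv s : coinv rho s -> rho s = s ⊗ₜ e.
Proof.
move=> /coinvP/(_ 1); rewrite mulr1 => /= ->.
by apply: etrans (congr1 (lact s) coaction_one) _; tensor_simp; rewrite mulr1.
Qed.

Section Invertible.
Variable psiV : A ⊗ C -> C ⊗ A.
Hypotheses (psiK : cancel psi psiV) (psiVK : cancel psiV psi).

Lemma lin_psiV : lin psiV.
Proof. by move=> a u v; apply: (can_inj psiK); rewrite linearP !psiVK. Qed.
#[local] Hint Resolve lin_psiV : lin.

(** The mirror image of a |-> psi (e ⊗ a), available since psi is invertible *)
Definition left_coaction (a : A) : C ⊗ A := psiV (a ⊗ₜ e).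
Local Notation lam := left_coaction.

Lemma lin_left_coaction : lin lam.
Proof. by rewrite /left_coaction; prove_lin. Qed.
#[local] Hint Resolve lin_left_coaction : lin.

(** The composite Phi of psi past both factors is injective and carries both
    sides to a ⊗ (e ⊗ e). *)
Lemma left_coactionA a :
  assoc (tmap comul idfun (lam a)) = tmap idfun lam (lam a).
Proof.
pose Phi (t : C ⊗ (C ⊗ A)) := assoc (tmap psi idfun (assocV (tmap idfun psi t))).
pose PhiV (t : A ⊗ (C ⊗ C)) := tmap idfun psiV (assoc (tmap psiV idfun (assocV t))).
have PhiK : cancel Phi PhiV.
  move=> t; rewrite /PhiV /Phi assocK.
  rewrite (tmap_cancel _ _ _ _ psiK (fun=> erefl)); try prove_lin.
  by rewrite assocVK (tmap_cancel _ _ _ _ (fun=> erefl) psiK); try prove_lin.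
apply: (can_inj PhiK).
rewrite /Phi -(entwining_comul psi_entw) /left_coaction psiVK; tensor_simp.
rewrite e_grp.1 -(assocE a e e) -[a ⊗ₜ e in LHS]psiVK.
move: (psiV _) => u; congr assoc; by_tensors u=> c b; tensor_simp.
by rewrite psiVK; tensor_simp.
Qed.

(** Up to psi, the lifted canonical map is a ⊗ b |-> lam a . b, so that it also
    respects the left coaction lam. *)
Lemma lifted_can_left t :
  psi (tmap idfun (@tmul k A) (assoc (tmap lam idfun t))) = lifted_can rho t.
Proof.
by_tensors t=> a b; tensor_simp.
rewrite lifted_can_pure -ractE -[a ⊗ₜ e]psiVK -/(lam a).
by move: (lam a) => u; by_tensors u=> c x; tensor_simp; rewrite tmulE psi_mul.
Qed.

Lemma lifted_can_left' t :
  tmap idfun (@tmul k A) (assoc (tmap lam idfun t)) = psiV (lifted_can rho t).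
Proof. by rewrite -lifted_can_left psiK. Qed.

End Invertible.
End Entwined.

(** * Construction of a strong connection *)

#[local] Hint Resolve lin_rpush lin_raverage lin_lpush lin_laverage : lin.
#[local] Hint Resolve lin_ract lin_coaction lin_lifted_can lin_left_coaction : lin.

Section StrongConnection.
Variables (k : fieldType) (A : algType k) (C : coalgType k).
Variables (psi : {linear C ⊗ A -> A ⊗ C}) (e : C).
Hypotheses (psi_entw : entwining psi) (e_grp : grouplike e).
Variable psiV : A ⊗ C -> C ⊗ A.
Hypotheses (psiK : cancel psi psiV) (psiVK : cancel psiV psi).
Variable p : C ⊗ C -> C.
Hypotheses (p_lin : lin p) (p_sec : forall c, p (comul c) = c).
Hypothesis p_left : left_colinear (tensor_lcoact comul) comul p.
Hypothesis p_right : right_colinear (tensor_rcoact comul) comul p.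

Local Notation rho := (entwined_coaction psi e).
Local Notation lam := (left_coaction e psiV).
Local Notation rav := (raverage rho p).
Local Notation lav := (laverage lam p).

Variable tau : A ⊗ C -> A ⊗ A.
Hypotheses (tau_lin : lin tau) (tauK : cancel tau (lifted_can rho)).

Let lam_lin : lin lam. Proof. exact: lin_left_coaction. Qed.
Let rav_lin : lin rav. Proof. by apply: lin_raverage; prove_lin. Qed.
Let lav_lin : lin lav. Proof. by apply: lin_laverage; prove_lin. Qed.
Let rhoA := coactionA psi_entw e_grp.
Let lamA := left_coactionA psi_entw e_grp psiK psiVK.

(** c |-> tau (1 ⊗ c_1) averaged against c_2 on the right factor *)
Definition rtrans (c : C) : A ⊗ A :=
  tmap idfun rav (assoc (tmap (fun d => tau (1 ⊗ₜ d)) idfun (comul c))).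

Lemma lin_rtrans : lin rtrans.
Proof. by rewrite /rtrans; prove_lin. Qed.
#[local] Hint Resolve lin_rtrans : lin.

(** can~ turns averaging against d into p (_ ⊗ d), and p retracts the coproduct. *)
Lemma rtrans_can c : lifted_can rho (rtrans c) = 1 ⊗ₜ c.
Proof.
have canE t d : lifted_can rho (tmap idfun rav (assoc (t ⊗ₜ d))) =
                tmap idfun p (assoc (lifted_can rho t ⊗ₜ d)).
  by_tensors t=> a b; tensor_simp; rewrite !lifted_can_pure raverage_push // /rpush; tensor_simp.
  by move: (rho b) => u; by_tensors u=> x y; tensor_simp.
rewrite -[in RHS](p_sec c) /rtrans.
by move: (comul c) => v; by_tensors v=> x y; tensor_simp; rewrite canE tauK; tensor_simp.
Qed.

Lemma rtrans_right c :
  tmap idfun rho (rtrans c) = assoc (tmap rtrans idfun (comul c)).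
Proof.
pose K (v : C ⊗ C) := tmap idfun rav (assoc (tmap (fun d => tau (1 ⊗ₜ d)) idfun v)).
have Klin : lin K by rewrite /K; prove_lin.
transitivity (assoc (tmap K idfun (assocV (tmap idfun comul (comul c))))).
  rewrite /rtrans; move: (comul c) => v; by_tensors v=> x y; tensor_simp.
  transitivity (tmap idfun (tmap rav idfun)
                  (tmap idfun (@assocV _ _ _ _) (assoc (tau (1 ⊗ₜ x) ⊗ₜ comul y)))).
    move: (tau _) => t; by_tensors t=> a b; tensor_simp.
    by rewrite raverage_colinear //; tensor_simp.
  move: (comul y) => w; by_tensors w=> y1 y2; rewrite /K; tensor_simp.
  by move: (tau _) => t'; by_tensors t'=> a b; tensor_simp.
rewrite -comulA assocK; move: (comul c) => v; by_tensors v=> x y; by tensor_simp.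
Qed.

(** The strong connection: c_1 averaged against rtrans c_2 on the left factor *)
Definition ell (c : C) : A ⊗ A :=
  tmap lav idfun (assocV (tmap idfun rtrans (comul c))).

Lemma lin_ell : lin ell.
Proof. by rewrite /ell; prove_lin. Qed.
#[local] Hint Resolve lin_ell : lin.

(** Composed with psi^-1, can~ turns averaging against d on the left into
    p (d ⊗ _), and psi^-1 (1 ⊗ c) = c ⊗ 1. *)
Lemma ell_can c : lifted_can rho (ell c) = 1 ⊗ₜ c.
Proof.
pose lcan t := tmap idfun (@tmul k A) (assoc (tmap lam idfun t)).
have lcan_lin : lin lcan by rewrite /lcan; prove_lin.
have lcanE d t : lcan (tmap lav idfun (assocV (d ⊗ₜ t))) =
                 tmap p idfun (assocV (d ⊗ₜ lcan t)).
  rewrite /lcan; by_tensors t=> a b; tensor_simp; rewrite laverage_push // /lpush; tensor_simp.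
  by move: (lam a) => u; by_tensors u=> x y; tensor_simp.
have lcan_rtrans d : lcan (rtrans d) = d ⊗ₜ 1.
  rewrite /lcan (lifted_can_left' e psi_entw psiK psiVK) rtrans_can.
  by rewrite -(entwining_one psi_entw) psiK.
rewrite -(lifted_can_left e psi_entw psiK psiVK) -/(lcan _).
rewrite -(entwining_one psi_entw); congr (psi _).
rewrite -[in RHS](p_sec c) /ell.
by move: (comul c) => v; by_tensors v=> x y; tensor_simp; rewrite lcanE lcan_rtrans; tensor_simp.
Qed.

Lemma ell_left c : assoc (tmap lam idfun (ell c)) = tmap idfun ell (comul c).
Proof.
pose K (v : C ⊗ C) := tmap lav idfun (assocV (tmap idfun rtrans v)).
have Klin : lin K by rewrite /K; prove_lin.
transitivity (tmap idfun K (assoc (tmap comul idfun (comul c)))).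
  rewrite /ell; move: (comul c) => v; by_tensors v=> x y; tensor_simp.
  transitivity (tmap idfun (tmap lav idfun)
     (tmap idfun (@assocV _ _ _ _) (assoc (comul x ⊗ₜ rtrans y)))).
    move: (rtrans y) => t; by_tensors t=> a b; tensor_simp.
    rewrite laverage_colinear //; tensor_simp.
    by move: (comul x) => w; by_tensors w=> x1 x2; tensor_simp.
  by move: (comul x) => w; by_tensors w=> x1 x2; rewrite /K; tensor_simp.
rewrite comulA; move: (comul c) => v; by_tensors v=> x y; by tensor_simp.
Qed.

(** Left averaging only touches the left factor, so right colinearity of rtrans
    survives it. *)
Lemma ell_right c : tmap idfun rho (ell c) = assoc (tmap ell idfun (comul c)).
Proof.
pose Q (v : C ⊗ C) := assoc (tmap rtrans idfun v).
have Qlin : lin Q by rewrite /Q; prove_lin.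
transitivity (tmap lav idfun (assocV (tmap idfun Q (tmap idfun comul (comul c))))).
  rewrite /ell; move: (comul c) => v; by_tensors v=> x y; tensor_simp.
  rewrite /Q -rtrans_right.
  by move: (rtrans y) => t; by_tensors t=> a b; tensor_simp.
rewrite -comulA; move: (comul c) => v; by_tensors v=> x y; tensor_simp.
rewrite /ell /Q; move: (comul x) => w; by_tensors w=> x1 x2; tensor_simp.
by move: (rtrans x2) => t; by_tensors t=> a b; tensor_simp.
Qed.

End StrongConnection.

(** * Principality from a strong connection *)

Section FromStrongConnection.
Variables (k : fieldType) (A : algType k) (C : coalgType k).
Variables (psi : {linear C ⊗ A -> A ⊗ C}) (e : C).
Hypotheses (psi_entw : entwining psi) (e_grp : grouplike e).
Variable psiV : A ⊗ C -> C ⊗ A.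
Hypotheses (psiK : cancel psi psiV) (psiVK : cancel psiV psi).

Local Notation rho := (entwined_coaction psi e).
Local Notation lam := (left_coaction e psiV).

Variable ell : C -> A ⊗ A.
Hypothesis ell_lin : lin ell.
Hypothesis ell_can : forall c, lifted_can rho (ell c) = 1 ⊗ₜ c.
Hypothesis ell_left :
  forall c, assoc (tmap lam idfun (ell c)) = tmap idfun ell (comul c).
Hypothesis ell_right :
  forall c, tmap idfun rho (ell c) = assoc (tmap ell idfun (comul c)).

(** a ⊗ c |-> a ell c *)
Definition can_section (y : A ⊗ C) : A ⊗ A := lmul (tmap idfun ell y).
Local Notation kappa := can_section.

Lemma lin_can_section : lin kappa.
Proof. by rewrite /can_section; prove_lin. Qed.
#[local] Hint Resolve lin_can_section : lin.

Lemma can_section_pure a c : kappa (a ⊗ₜ c) = lact a (ell c).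
Proof. by rewrite /can_section; tensor_simp; rewrite lmulE. Qed.

Lemma can_section_lact a y : kappa (lact a y) = lact a (kappa y).
Proof. by by_tensors y=> b c; tensor_simp; rewrite !can_section_pure lactM. Qed.

Lemma can_sectionK : cancel kappa (lifted_can rho).
Proof.
move=> y; by_tensors y=> a c.
by rewrite can_section_pure lifted_can_lact ell_can; tensor_simp; rewrite mulr1.
Qed.

Lemma can_section_right y :
  tmap idfun rho (kappa y) = assoc (tmap kappa idfun (assocV (tmap idfun comul y))).
Proof.
by_tensors y=> a c; rewrite can_section_pure lact_tmap ?ell_right; try prove_lin; tensor_simp.
move: (comul c) => v; by_tensors v=> x z; tensor_simp; rewrite can_section_pure.
by move: (ell x) => t; by_tensors t=> b b'; tensor_simp.
Qed.

(** In Sweedler notation, writing ell c = x ⊗ y, the left factor satisfies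
    rho (a_0 x) = a_0 psi (a_1 ⊗ x); left colinearity of ell gives
    psi (c_1 ⊗ x (c_2)) ⊗ y (c_2) = (x ⊗ e) ⊗ y, which collapses it to
    a_0 x ⊗ e. *)
Lemma can_section_coinv a :
  tmap rho idfun (kappa (rho a)) = tmap (fun b : A => b ⊗ₜ e) idfun (kappa (rho a)).
Proof.
have ract_lin := lin_ract psi.
(* (b ⊗ d) ⊗ c |-> (b ⊗ d) x ⊗ y with ell c = x ⊗ y *)
pose H (z : (A ⊗ C) ⊗ C) := tmap (ract psi) idfun (assocV (tmap idfun ell z)).
have Hlin : lin H by rewrite /H; prove_lin.
transitivity (H (tmap rho idfun (rho a))).
  move: (rho a) => u; by_tensors u=> b c; tensor_simp; rewrite can_section_pure /H; tensor_simp.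
  move: (ell c) => t; by_tensors t=> x y; tensor_simp.
  by rewrite coaction_mul.
rewrite -[tmap rho idfun (rho a)]assocK coactionA //.
move: (rho a) => u; by_tensors u=> b c; tensor_simp; rewrite can_section_pure.
have lam_lin : lin lam by exact: lin_left_coaction.
transitivity (tmap (lact b) idfun (tmap psi idfun (assocV (tmap idfun ell (comul c))))).
  move: (comul c) => v; by_tensors v=> x y; rewrite /H; tensor_simp.
  move: (ell y) => t; by_tensors t=> z w; tensor_simp.
  by rewrite ractE.
rewrite -ell_left assocK; move: (ell c) => t; by_tensors t=> x y; tensor_simp.
by rewrite /left_coaction psiVK; tensor_simp.
Qed.

Variable p : C ⊗ C -> C.
Hypotheses (p_lin : lin p) (p_sec : forall c, p (comul c) = c).
Hypothesis p_left : left_colinear (tensor_lcoact comul) comul p.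
Hypothesis p_right : right_colinear (tensor_rcoact comul) comul p.
Local Notation rav := (raverage rho p).
Let rhoA := coactionA psi_entw e_grp.

(** a ⊗ c |-> a counit (p (c ⊗ e)), through which a |-> rav (a ⊗ e) factors; it
    inverts a |-> a ⊗ e because p (e ⊗ e) = e. *)
Let Q (u : A ⊗ C) : A := runit (tmap idfun counit (tmap idfun p (assoc (u ⊗ₜ e)))).
Let Q_lin : lin Q. Proof. by rewrite /Q; prove_lin. Qed.
Let Q_pure a : Q (a ⊗ₜ e) = a.
Proof. by rewrite /Q; tensor_simp; rewrite -e_grp.1 p_sec e_grp.2 scale1r. Qed.
Let QE a : rav (a ⊗ₜ e) = Q (rho a).
Proof. by rewrite /raverage /rpush /Q; tensor_simp. Qed.
Let rav_lin : lin rav. Proof. by apply: lin_raverage; prove_lin. Qed.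

(** The colinear map rav sends a ⊗ e to an element with coaction rav (a ⊗ e) ⊗ e,
    as e is group-like. *)
Lemma raverage_coinv a : coinv rho (rav (a ⊗ₜ e)).
Proof.
apply: coinv_of_coaction => //.
by rewrite raverage_colinear //; tensor_simp; rewrite e_grp.1; tensor_simp.
Qed.

Definition coinv_proj (a : A) : coinvariants rho := Sub (rav (a ⊗ₜ e)) (raverage_coinv a).

Lemma coinv_projE a : val (coinv_proj a) = rav (a ⊗ₜ e).
Proof. by rewrite /coinv_proj SubK. Qed.

Lemma lin_val : lin (val : coinvariants rho -> A).
Proof. by move=> c s t; rewrite linearP. Qed.
#[local] Hint Resolve lin_val : lin.

Lemma lin_coinv_proj : lin coinv_proj.
Proof.
move=> c a b; apply: val_inj; rewrite lin_val !coinv_projE.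
by rewrite tpureDl tpureZl rav_lin.
Qed.
#[local] Hint Resolve lin_coinv_proj : lin.

Lemma coinv_projK : cancel val coinv_proj.
Proof.
move=> s; apply: val_inj; rewrite coinv_projE QE.
by rewrite (coaction_of_coinv psi_entw (valP s)) Q_pure.
Qed.

Definition SA_section (a : A) : coinvariants rho ⊗ A :=
  tmap coinv_proj idfun (kappa (rho a)).
Local Notation sigma := SA_section.

Lemma lin_SA_section : lin sigma.
Proof. by rewrite /SA_section; prove_lin. Qed.
#[local] Hint Resolve lin_SA_section : lin.

(** Q undoes a |-> a ⊗ e, so it fixes the left factor of kappa (rho a), which
    is coinvariant. *)
Lemma SA_section_val a : tmap val idfun (sigma a) = kappa (rho a).
Proof.
have QK t : tmap Q idfun (tmap (fun b : A => b ⊗ₜ e) idfun t) = t.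
  by by_tensors t=> x y; tensor_simp; rewrite Q_pure.
rewrite -[RHS]QK -can_section_coinv /SA_section.
move: (kappa _) => t; by_tensors t=> x y; tensor_simp.
by rewrite QE.
Qed.

Lemma tmap_val_inj : injective (tmap val idfun : coinvariants rho ⊗ A -> A ⊗ A).
Proof.
apply: (can_inj (g := tmap coinv_proj idfun)).
by apply: tmap_cancel; try prove_lin; first exact: coinv_projK.
Qed.

Lemma SA_section_linear (s : coinvariants rho) a : sigma (val s * a) = lact s (sigma a).
Proof.
apply: tmap_val_inj; rewrite SA_section_val.
have -> : rho (val s * a) = lact (val s) (rho a) by exact: (coinvP _ _ (valP s)).
rewrite can_section_lact -SA_section_val.
by move: (sigma a) => z; by_tensors z=> x y; tensor_simp.
Qed.

Lemma SA_section_colinear : right_colinear rho (tensor_rcoact rho) sigma.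
Proof.
move=> a; rewrite /tensor_rcoact /= /SA_section.
transitivity (tmap (tmap coinv_proj idfun) idfun (assocV (tmap idfun rho (kappa (rho a))))).
  move: (kappa _) => t; by_tensors t=> x y; tensor_simp.
  by move: (rho y) => u; by_tensors u=> z w; tensor_simp.
rewrite can_section_right assocK -coactionA // assocK.
by move: (rho a) => u; by_tensors u=> x y; tensor_simp.
Qed.

Lemma mulSA_val (z : coinvariants rho ⊗ A) : mulSA z = tmul (tmap val idfun z).
Proof.
have ? : lin (@mulSA k A C rho).
  by move=> c u v; apply: tlift_linear; split=> [b|x] d y z'; 
     rewrite ?linearP ?mulrDl ?mulrDr -?scalerAl -?scalerAr.
by by_tensors z=> s a; tensor_simp; rewrite mulSAE tmulE.
Qed.

(** The product of A is the counit applied to can~, and can~ o kappa is the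
    identity. *)
Lemma SA_sectionK : cancel sigma (@mulSA k A C rho).
Proof.
move=> a; rewrite mulSA_val SA_section_val -(lifted_can_counit psi_entw e_grp).
by rewrite can_sectionK coaction_counit.
Qed.

Local Notation proj := (qproj (balanced_rel rho)).

Lemma can_proj t : can (proj t) = lifted_can rho t.
Proof.
have ? : lin (@can k A C rho) by exact: can_linear.
have ? : lin (proj : A ⊗ A -> tensorS rho) by exact: qproj_linear.
by by_tensors t=> a b; rewrite lifted_can_pure; exact: canE.
Qed.

Lemma proj_balanced (a b : A) (s : coinvariants rho) :
  proj ((a * val s) ⊗ₜ b) = proj (a ⊗ₜ (val s * b)).
Proof.
apply/qprojP/asboolP => P _; apply; exact: (Balanced _ _ (valP s)).
Qed.

(** a ⊗ b goes to a . kappa (rho b), which is a acting on sigma b in S ⊗ A;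
    moving the factors in S across the tensor sign multiplies sigma b out
    to b. *)
Lemma can_sectionK_proj t : proj (kappa (lifted_can rho t)) = proj t.
Proof.
have ? : lin (proj : A ⊗ A -> tensorS rho) by exact: qproj_linear.
by_tensors t=> a b; rewrite lifted_can_pure can_section_lact -SA_section_val.
rewrite -[in RHS](SA_sectionK b) mulSA_val.
move: (sigma b) => z; by_tensors z=> s x; tensor_simp.
by rewrite tmulE proj_balanced.
Qed.

Lemma can_bijective : bijective (@can k A C rho).
Proof.
exists (fun y => proj (kappa y)) => [x|y]; last by rewrite can_proj can_sectionK.
by have [t ->] := qprojW x; rewrite can_proj can_sectionK_proj.
Qed.

(** can^-1 (1 ⊗ c) is the class of ell c, and can~ is right A-linear. *)
Lemma can_entwining_psi : @can_entwining k A C rho =1 psi.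
Proof.
have [canK invK] := can_invK can_bijective.
have ? : lin (@can k A C rho) by exact: can_linear.
have proj_lin : lin (proj : A ⊗ A -> tensorS rho) by exact: qproj_linear.
have ract_lin (b : A) : lin (@ractS k A C rho b) by exact: ractS_linear.
have entw_lin : lin (@can_entwining k A C rho).
  apply: tlift_linear; split=> [b|c] d u v; last by rewrite ractS_linearr can_linear.
  rewrite -can_linear -ractS_linear; congr (can (ractS b _)).
  by apply: (bij_inj can_bijective); rewrite can_linear !invK tpureDr tpureZr.
move=> t; by_tensors t=> c a.
rewrite can_entwiningE; last exact: can_bijective.
have -> : can_inv rho (1 ⊗ₜ c) = proj (ell c).
  by apply: (bij_inj can_bijective); rewrite invK can_proj ell_can.
have -> : ractS a (proj (ell c)) = proj (tmap idfun (fun x : A => x * a) (ell c)).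
  by move: (ell c) => t; by_tensors t=> x y; tensor_simp; exact: ractSE.
by rewrite can_proj lifted_can_ract // ell_can ractE lact1.
Qed.

Lemma principal_of_strong_connection : principal_extension rho.
Proof.
split.
- exact: entwined_comodule.
- exact: can_bijective.
- pose S : {linear A -> coinvariants rho ⊗ A} :=
    HB.pack sigma (GRing.isLinear.Build k A (coinvariants rho ⊗ A) *:%R sigma lin_SA_section).
  exists S; split; [exact: SA_section_linear | exact: SA_section_colinear |].
  exact: SA_sectionK.
- by exists psiV => x; [rewrite can_entwining_psi psiK | rewrite can_entwining_psi psiVK].
- by exists e => // a; rewrite can_entwining_psi.
Qed.

End FromStrongConnection.

Theorem theorem4p6 (k : fieldType) (A : algType k) (C : coalgType k)
    (psi : {linear C ⊗ A -> A ⊗ C}) (e : C)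
    (psi_entwining : entwining psi)
    (psi_bij : bijective psi)
    (e_grouplike : grouplike e)
    (C_coseparable : coseparable C)
    (can_surj : forall y : A ⊗ C,
       exists x : A ⊗ A, lifted_can (entwined_coaction psi e) x = y) :
  principal_extension (entwined_coaction psi e).
Proof.
have [psiV psiK psiVK] := psi_bij.
have [p [p_right p_left p_sec]] := C_coseparable.
have [tau tauK] := linear_section can_surj.
have p_lin : lin p := lin_linear p.
have tau_lin : lin tau := lin_linear tau.
pose l := ell psi e psiV p tau.
have l_lin : lin l by exact: lin_ell.
have l_can c : lifted_can (entwined_coaction psi e) (l c) = 1 ⊗ₜ c.
  exact: ell_can.
have l_left c :
    assoc (tmap (left_coaction e psiV) idfun (l c)) = tmap idfun l (comul c).
  exact: ell_left.
have l_right c :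
    tmap idfun (entwined_coaction psi e) (l c) = assoc (tmap l idfun (comul c)).
  exact: ell_right.
exact: (principal_of_strong_connection psi_entwining e_grouplike psiK psiVK
  l_lin l_can l_left l_right p_lin p_sec p_left p_right).
Qed.
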